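(* Let $F(n)=\#\{(x,y)\in\mathbb{Z}^2 : x^2+2y^2\le n\}$ be the number of lattice points contained in the elliptical region $x^2+2y^2\le n$. Then $F(0)=1$, $F(1)=3$, $F(2)=5$, $F(5)=11$, and for all $n\in\mathbb{N}$ with $n\ne 1,2,5$, $$F(n) = 1+2\,\mathcal{N}_{\lceil n/4\rceil,\,3/4,\,\{-n/4\},\,1,\,2}+2\,\mathcal{N}_{\lceil n/4\rceil,\,1/4,\,\{-n/4\},\,1,\,2}+2n+2\left\lfloor\frac{n}{3}\right\rfloor-4\left\lceil\frac{n}{4}\right\rceil.$$
   Context: $\mathbb{N}$ denotes the set of positive integers; $\lfloor\cdot\rfloor$ and $\lceil\cdot\rceil$ are the floor and ceiling functions, and $\{x\}=x-\lfloor x\rfloor$ is the fractional part of $x\in\mathbb{R}$. For $n,m\in\mathbb{N}$, $r\in\mathbb{Z}$ and $\alpha,\nu\in\mathbb{R}$, define $$\mathcal{N}_{n,\alpha,\nu,r,m}=\#\left\{k\in\mathbb{Z} : 1\le k\le n,\ \left\lfloor\frac{n-\nu}{k}+\alpha\right\rfloor\equiv r \pmod m\right\}.$$ *)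

(* Defs.v *)
From mathcomp Require Export all_boot all_order all_algebra.
From mathcomp Require Export finmap.
From mathcomp Require Export boolp classical_sets functions cardinality reals.

Set Implicit Arguments.
Unset Strict Implicit.
Unset Printing Implicit Defensive.

Import Order.TTheory GRing.Theory Num.Theory.
Local Open Scope classical_set_scope.
Local Open Scope ring_scope.

Definition frac_part (R : realType) (x : R) : R := x - (Num.floor x)%:~R.

(* [n] is taken in [int] because it is instantiated by a ceiling. *)
Definition floor_set (R : realType) (n : int) (alpha nu : R) (r : int)
    (m : nat) : set int :=
  [set k | 1 <= k <= n /\
    (Num.floor ((n%:~R - nu) / k%:~R + alpha) = r %[mod m])%Z].

(* [fset_set] of an infinite set is empty; [floor_set_finite] and
   [ellipse_finite] show that this case never arises below. *)
Definition floor_count (R : realType) (n : int) (alpha nu : R) (r : int)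
    (m : nat) : nat :=
  #|` fset_set (floor_set n alpha nu r m) |.

Definition ellipse (n : nat) : set (int * int) :=
  [set p | p.1 ^+ 2 + 2 * p.2 ^+ 2 <= n%:Z].

Definition ellipse_count (n : nat) : nat := #|` fset_set (ellipse n) |.

Lemma finite_int_ball (N : nat) : finite_set [set k : int | `|k| <= N%:Z].
Proof.
apply: (@sub_finite_set _ _
  [set` [seq i%:Z - N%:Z | i <- iota 0 (N + N).+1]]); last exact: finite_seq.
move=> k /=; rewrite ler_norml => /andP[kl ku].
have k0 : 0 <= k + N%:Z by rewrite -lerBlDr sub0r.
suff /mapP : exists2 i, i \in iota 0 (N + N).+1 & k = i%:Z - N%:Z by [].
exists `|(k + N%:Z)%R|%N.
  by rewrite mem_iota add0n leq0n ltnS -lez_nat gez0_abs // PoszD lerD2r.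
by rewrite gez0_abs // addrK.
Qed.

Lemma floor_set_finite (R : realType) (n : int) (alpha nu : R) (r : int)
    (m : nat) : finite_set (floor_set n alpha nu r m).
Proof.
apply: sub_finite_set (finite_int_ball `|n|%N) => k [/andP[k1 kn] _] /=.
have k0 : 0 <= k by apply: le_trans k1.
by rewrite abszE !ger0_norm // (le_trans k0).
Qed.

Lemma ellipse_finite (n : nat) : finite_set (ellipse n).
Proof.
apply: sub_finite_set
  (finite_setX (finite_int_ball n) (finite_int_ball n)) => -[x y] /= xy.
have sq (z : int) : `|z| <= z ^+ 2.
  rewrite -real_normK ?num_real // expr2.
  have [->|z0] := eqVneq z 0; first by rewrite normr0 mul0r.
  by rewrite ler_peMl // -gtz0_ge1 normr_gt0.
split.
  by apply: le_trans (sq x) (le_trans _ xy); rewrite lerDl mulr_ge0 ?sqr_ge0.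
apply: le_trans (sq y) (le_trans _ xy).
by rewrite mulr_natl mulr2n addrA lerDr addr_ge0 ?sqr_ge0.
Qed.

(* Main.v *)
Require Import Defs.
From mathcomp Require Import all_field zify ring lra.
Import Order.TTheory GRing.Theory Num.Theory.
Local Open Scope ring_scope.

(** Let chi = (-2/.) and let r(m) be the number of representations of m by
    x^2 + 2y^2. Dirichlet's formula r(m) = 2 sum_{k | m} chi(m/k) holds because
    both sides f satisfy f(pn) = (1 + chi(p)) f(n) - chi(p) f(n/p) for p prime
    (the last term being absent when p does not divide n). For r, this is
    inclusion-exclusion on the multiples of pi and of its conjugate in
    Z[sqrt(-2)] when p = N(pi), and the fact that p divides both coordinates
    when p is inert. By Thue's lemma an odd p is a norm as soon as -2 is a
    square mod p, which by the supplementary laws happens when chi(p) = 1;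
    conversely norms are 1 or 3 mod 8 when odd.
    Summing over m <= n gives F(n) = 1 + 2 sum_{k <= n} psi(n/k), where
    psi(q) = chi(1) + ... + chi(q) counts the odd numbers among
    floor((q+3)/4) and floor((q+1)/4). For k > n/4 these floors are 0 or 1, which
    leaves the explicit terms in n, floor(n/3) and ceil(n/4) as soon as
    ceil(n/4) <= floor(n/3), that is, for n not in {1, 2, 5}. *)

(** * Thue's lemma and primes of the form x^2 + 2y^2 *)

Lemma sqrt_bracket (n : nat) : exists k : nat, (k * k <= n < k.+1 * k.+1)%N.
Proof.
elim: n => [|n [k /andP[h1 h2]]]; first by exists 0%N.
have [h|h] := ltnP n.+1 (k.+1 * k.+1); first by exists k; nia.
by exists k.+1; nia.
Qed.

Lemma prime_not_square (p k : nat) : prime p -> (k * k)%N <> p.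
Proof.
move=> p_pr kkp; have : (k %| p)%N by rewrite -kkp dvdn_mulr.
move=> /(primeP p_pr).2 /orP[] /eqP hk; have := prime_gt1 p_pr; nia.
Qed.

Lemma dvdz_Fp (p : nat) (x : int) :
  prime p -> (p %| x)%Z = (x%:~R == 0 :> 'F_p).
Proof. by move=> p_pr; apply: dvdz_pcharf; apply: pchar_Fp. Qed.

Lemma prime_dvdzM (p : nat) (x y : int) :
  prime p -> (p %| x * y)%Z = (p %| x)%Z || (p %| y)%Z.
Proof. by move=> p_pr; rewrite !dvdzE abszM Euclid_dvdM. Qed.

(** Pigeonhole: with k^2 < p < (k+1)^2, the (k+1)^2 pairs (i, j) with 0 <= i, j <= k cannot have
    distinct values i - z j in ['F_p]. The differences of two colliding pairs are at most k in
    absolute value. *)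
Lemma Thue (p : nat) (z : 'F_p) : prime p ->
  exists x y : int, [/\ (x != 0) || (y != 0), x ^+ 2 < p%:Z, y ^+ 2 < p%:Z
    & x%:~R = z * y%:~R].
Proof.
move=> p_pr; have [k /andP[k1 k2]] := sqrt_bracket p.
have {}k1 : (k * k < p)%N.
  by rewrite ltn_neqAle k1 andbT; apply/eqP/prime_not_square.
pose g (i : 'I_k.+1 * 'I_k.+1) : 'F_p := (i.1)%:R - z * (i.2)%:R.
have /injectivePn[[a b] [[c d] ne eqg]] : ~~ injectiveb g.
  apply/negP => /injectiveP /leq_card; rewrite card_prod (card_Fp p_pr) !card_ord.
  by rewrite leqNgt k2.
exists (a%:Z - c%:Z), (b%:Z - d%:Z); split.
- apply: contraNT ne; rewrite negb_or !negbK !subr_eq0 => /andP[/eqP e1 /eqP e2].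
  by apply/eqP; congr pair; apply/val_inj => /=; lia.
- have := ltn_ord a; have := ltn_ord c; nia.
- have := ltn_ord b; have := ltn_ord d; nia.
move/eqP: eqg; rewrite /g /=; rewrite -subr_eq0 => /eqP eqg.
by apply/eqP; rewrite -subr_eq0 -eqg !rmorphB /= -!pmulrn; apply/eqP; ring.
Qed.

Lemma sqr_mod8 (x : int) : exists q : int,
  x ^+ 2 = 8 * q \/ x ^+ 2 = 8 * q + 4 \/ x ^+ 2 = 8 * q + 1.
Proof.
have [m [->|[->|[->|->]]]] : exists m : int,
    x = 4 * m \/ x = 4 * m + 1 \/ x = 4 * m + 2 \/ x = 4 * m + 3.
  by exists (x %/ 4)%Z; lia.
- by exists (2 * m ^+ 2); left; ring.
- by exists (2 * m ^+ 2 + m); right; right; ring.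
- by exists (2 * m ^+ 2 + 2 * m); right; left; ring.
- by exists (2 * m ^+ 2 + 3 * m + 1); right; right; ring.
Qed.

(** Thue's x^2 + 2y^2 is a multiple of p strictly between 0 and 3p. If it is 2p, then x is even and
    y^2 + 2(x/2)^2 = p. *)
Lemma prime_form (p : nat) (z : 'F_p) : prime p -> z ^+ 2 = - 2 ->
  exists a b : int, a ^+ 2 + 2 * b ^+ 2 = p%:Z.
Proof.
move=> p_pr z2; have [x [y [nz x2 y2 xy]]] := Thue _ z p_pr.
have : (p %| x ^+ 2 + 2 * y ^+ 2)%Z.
  rewrite dvdz_Fp // !expr2 rmorphD !rmorphM /= xy -!expr2 exprMn z2.
  by apply/eqP; ring.
case/dvdzP => q hq.
have q0 : 0 < q.
  have : 0 < x ^+ 2 + 2 * y ^+ 2.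
    by case/orP: nz => /eqP; nia.
  nia.
have [q1|q2] : q = 1 \/ q = 2 by nia.
  by exists x, y; rewrite hq q1 mul1r.
have xE : x = 2 * (x %/ 2)%Z by nia.
exists y, (x %/ 2)%Z; nia.
Qed.

(** Thue's x^2 - 2y^2 is a multiple of p strictly between -2p and p. It is not 0, because the 2-adic
    valuations of x^2 and 2y^2 have different parities. *)
Lemma prime_form_diff (p : nat) (z : 'F_p) : prime p -> z ^+ 2 = 2 ->
  exists a b : int, a ^+ 2 - 2 * b ^+ 2 = - p%:Z.
Proof.
move=> p_pr z2; have [x [y [nz x2 y2 xy]]] := Thue _ z p_pr.
have : (p %| x ^+ 2 - 2 * y ^+ 2)%Z.
  rewrite dvdz_Fp // !expr2 rmorphB !rmorphM /= xy -!expr2 exprMn z2.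
  by apply/eqP; ring.
case/dvdzP => q hq.
have [q0|q1] : q = 0 \/ q = -1 by nia.
  have e : (`|x| * `|x| = 2 * (`|y| * `|y|))%N by rewrite -!abszM; nia.
  have y0 : (0 < `|y|)%N by case/orP: nz => /eqP; nia.
  have x0 : (0 < `|x|)%N by nia.
  have := congr1 (logn 2) e; rewrite !lognM ?muln_gt0 ?x0 ?y0 //.
  by rewrite (pfactorK 1) //; lia.
by exists x, y; rewrite hq q1 mulN1r.
Qed.

Lemma Fp_expf_half (p : nat) (x : 'F_p) : prime p -> odd p -> x != 0 ->
  (x ^+ (p.-1./2) == 1) || (x ^+ (p.-1./2) == -1).
Proof.
move=> p_pr p_odd x0.
have : x ^+ p.-1 = 1.
  apply: (mulfI x0); rewrite -exprS prednK ?prime_gt0 // mulr1.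
  by have := expf_card x; rewrite card_Fp.
rewrite -{1}[p.-1]odd_double_half; have -> : odd p.-1 = false.
  by have := prime_gt0 p_pr; lia.
by rewrite add0n -muln2 exprM => /eqP; rewrite sqrf_eq1.
Qed.

(** * Supplementary laws: -2 as a square mod p *)

Lemma sqr_neg2_Fp (p : nat) : prime p -> ((p %% 8 == 1) || (p %% 8 == 3))%N ->
  exists z : 'F_p, z ^+ 2 = - 2.
Proof.
move=> p_pr p13; have p_odd : odd p by lia.
have half := fun x => Fp_expf_half p x p_pr p_odd.
case/orP: p13 => /eqP p8.
  have [x x1] : exists x : 'F_p, x ^+ (p.-1./2) = -1.
    (* Otherwise all p - 1 nonzero elements would be roots of X^((p-1)/2) - 1. *)
    have [|no] := pselect (exists x : 'F_p, x != 0 /\ x ^+ (p.-1./2) != 1).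
      by case=> x [/half/orP[->|/eqP] //]; exists x.
    have p1 := prime_gt1 p_pr.
    suff : (p.-1 <= p.-1./2)%N by lia.
    rewrite -[p in (p.-1 <= _)%N](card_Fp p_pr) -(cardC1 (0 : 'F_p)) cardE.
    apply: max_unity_roots; [lia| |exact: enum_uniq].
    apply/allP => x; rewrite mem_enum inE => x0; rewrite unity_rootE.
    by apply: contrapT => /negP h; apply: no; exists x.
  have x0 : x != 0.
    apply: contra_eq_neq x1 => ->; rewrite expr0n.
    have -> : (p.-1./2 == 0)%N = false by have := prime_gt1 p_pr; lia.
    by rewrite eq_sym oppr_eq0 oner_eq0.
  (* y is a primitive 8th root of unity. *)
  pose y := x ^+ (p %/ 8)%N.
  have y4 : y ^+ 4 = -1 by rewrite -exprM -x1; congr (_ ^+ _); lia.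
  have y0 : y != 0 by rewrite expf_eq0 (negPf x0) andbF.
  exists (y - y^-1).
  have -> : (y - y^-1) ^+ 2 = (y ^+ 4 + 1) / y ^+ 2 - 2 by field.
  by rewrite y4 addNr mul0r sub0r.
have h2 : (2 : 'F_p) != 0.
  by rewrite -(dvdz_Fp p 2) // dvdzE; apply/negP => /dvdn_leq => /(_ isT); lia.
(* As 4 divides p + 1, a square root of x is explicit: x^((p+1)/2) = x * x^((p-1)/2). *)
have sq (x : 'F_p) : x ^+ (p.-1./2) = 1 -> (x ^+ (p.+1 %/ 4)%N) ^+ 2 = x.
  move=> h; rewrite -exprM.
  have -> : (p.+1 %/ 4 * 2)%N = p.-1./2.+1 by lia.
  by rewrite exprS h mulr1.
(* 2 is not a square, otherwise p = 2b^2 - a^2 is +-1 mod 8; nor is -1. *)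
have [h|h] := orP (half 2 h2).
  have [a [b ab]] := prime_form_diff p _ p_pr (sq _ (eqP h)).
  have [q hq] := sqr_mod8 a; have [q' hq'] := sqr_mod8 b; lia.
exists ((-2) ^+ (p.+1 %/ 4)%N); apply: sq.
rewrite exprNn (eqP h) -signr_odd.
have -> : odd p.-1./2 by lia.
by rewrite mulrNN mulr1.
Qed.

(** * Representations as norms from Z[sqrt(-2)] *)

Definition rep (n : nat) : {fset int * int} :=
  fset_set [set u : int * int | u.1 ^+ 2 + 2 * u.2 ^+ 2 = n%:Z]%classic.

Lemma mem_rep (n : nat) (u : int * int) :
  (u \in rep n) = (u.1 ^+ 2 + 2 * u.2 ^+ 2 == n%:Z).
Proof.
rewrite in_fset_set; last first.
  by apply: sub_finite_set (ellipse_finite n) => v /= h; rewrite /ellipse /= h.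
by apply/idP/eqP => [/set_mem|h]; last exact: mem_set.
Qed.

Lemma card_fset_inj_image {T : choiceType} (A B : {fset T}) (f : T -> T) :
  injective f -> (forall u, u \in A -> f u \in B) ->
  (forall v, v \in B -> exists2 u, u \in A & f u = v) -> #|` A| = #|` B|.
Proof.
move=> f_inj fAB fBA; transitivity #|` [fset f u | u in A]%fset|.
  by rewrite card_imfset.
congr (#|` _|); apply/fsetP => v; apply/imfsetP/idP => /= [[u uA ->]|].
  exact: fAB.
by move=> /fBA[u uA <-]; exists u.
Qed.

(** Dividing both coordinates by p divides the norm by p^2, which takes p n to n/p. *)
Lemma card_rep_multiples (p n : nat) : (0 < p)%N ->
  #|` [fset u in rep (p * n) | (p %| u.1)%Z && (p %| u.2)%Z]%fset|
  = if (p %| n)%N then #|` rep (n %/ p)%N| else 0%N.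
Proof.
move=> p0; case: ifPn => [/dvdnP[m ->]|pn].
  rewrite mulnK //; symmetry.
  apply: (@card_fset_inj_image _ _ _ (fun u => (p%:Z * u.1, p%:Z * u.2))).
  - by move=> [a b] [c d] /= [ac bd]; congr pair; nia.
  - move=> [x y]; rewrite !inE !mem_rep /= !dvdz_mulr // => /eqP h.
    by rewrite !PoszM -h; apply/andP; split; [apply/eqP; ring|].
  move=> [x y]; rewrite !inE mem_rep /= => /andP[/eqP h].
  case/andP=> /dvdzP[a xE] /dvdzP[b yE]; exists (a, b) => /=; last by congr pair; lia.
  rewrite mem_rep /=; apply/eqP.
  apply: (@mulfI _ (p%:Z ^+ 2)); first by rewrite expf_neq0 //; lia.
  by move: h; rewrite xE yE !PoszM => h; lra.
apply/eqP; rewrite cardfs_eq0 -fsubset0; apply/fsubsetP => -[x y].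
rewrite !inE mem_rep /= => /andP[/eqP h].
case/andP=> /dvdzP[a xE] /dvdzP[b yE]; case/negP: pn.
suff : (p %| n%:Z)%Z by [].
apply/dvdzP; exists (a ^+ 2 + 2 * b ^+ 2).
by apply: (@mulfI _ p%:Z); [lia|rewrite -PoszM -h xE yE; ring].
Qed.

(** Up to the sign of the first coordinate, the bijection is multiplication by sqrt(-2), of norm
    2. *)
Lemma card_rep_double (n : nat) : #|` rep (2 * n)| = #|` rep n|.
Proof.
symmetry; apply: (@card_fset_inj_image _ _ _ (fun u => (2 * u.2, u.1))).
- by move=> [a b] [c d] /= [ac bd]; congr pair; lia.
- by move=> [x y]; rewrite !mem_rep /= => /eqP h; apply/eqP; rewrite PoszM -h; ring.
move=> [x y]; rewrite mem_rep /= => /eqP h.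
have /dvdzP[t xE] : (2 %| x)%Z.
  rewrite -[(2 %| x)%Z]orbb -(@prime_dvdzM 2) //; apply/dvdzP.
  by exists (n%:Z - y ^+ 2); lia.
exists (y, t) => /=; last by congr pair; lia.
by rewrite mem_rep /=; apply/eqP; move: h; rewrite xE PoszM; lia.
Qed.

(* With u = x + y sqrt(-2), the condition says that a + b sqrt(-2) divides u. *)
Lemma card_rep_factor (p n : nat) (a b : int) : prime p ->
  a ^+ 2 + 2 * b ^+ 2 = p%:Z ->
  #|` [fset u in rep (p * n) | (p %| u.2 * a - u.1 * b)%Z]%fset| = #|` rep n|.
Proof.
move=> p_pr ab; have p0 := prime_gt0 p_pr; have pz : p%:Z != 0 by lia.
symmetry; apply: (@card_fset_inj_image _ _ _
  (* Multiplication by a + b sqrt(-2). *)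
  (fun u => (u.1 * a - 2 * (u.2 * b), u.1 * b + u.2 * a))).
- move=> [x y] [z t] /= [e1 e2].
  have e1a := congr1 (fun w => a * w) e1; have e1b := congr1 (fun w => b * w) e1.
  have e2a := congr1 (fun w => a * w) e2; have e2b := congr1 (fun w => b * w) e2.
  by congr pair; apply: (mulfI pz); rewrite -ab; lra.
- move=> [x y]; rewrite !inE !mem_rep /= => /eqP h; apply/andP; split.
    by apply/eqP; rewrite PoszM -h -ab; ring.
  by apply/dvdzP; exists y; rewrite -ab; ring.
move=> [x y]; rewrite !inE mem_rep /= => /andP[/eqP h /dvdzP[t ht]].
(* In u (a - b sqrt(-2)), the norm is divisible by p and so is the imaginary part y a - x b; hence p
   divides the square of the real part. The quotient by p is the preimage (s, t). *)
have : (p %| (x * a + 2 * (y * b)) * (x * a + 2 * (y * b)))%Z.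
  apply/dvdzP; exists (p%:Z * n%:Z - 2 * t ^+ 2 * p%:Z).
  transitivity ((x ^+ 2 + 2 * y ^+ 2) * (a ^+ 2 + 2 * b ^+ 2)
    - 2 * (y * a - x * b) ^+ 2); first by ring.
  by rewrite h ab ht PoszM; ring.
rewrite prime_dvdzM // orbb => /dvdzP[s hs].
have xE : s * a - 2 * (t * b) = x.
  by apply: (mulfI pz); rewrite -{2}ab; move: (congr1 ( *%R a) hs) (congr1 ( *%R b) ht) => /=; lra.
have yE : s * b + t * a = y.
  by apply: (mulfI pz); rewrite -{2}ab; move: (congr1 ( *%R b) hs) (congr1 ( *%R a) ht) => /=; lra.
exists (s, t) => /=; last by rewrite xE yE.
rewrite mem_rep /=; apply/eqP; apply: (mulfI pz).
by rewrite -PoszM -h -xE -yE -ab; ring.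
Qed.

(** * The divisor sum of [chi] *)

(* The Kronecker symbol (-2/d). *)
Definition chi (d : nat) : int :=
  if (d %% 8)%N \in [:: 1; 3]%N then 1
  else if (d %% 8)%N \in [:: 5; 7]%N then -1 else 0.

Lemma chiM (d e : nat) : chi (d * e) = chi d * chi e.
Proof.
rewrite /chi -modnMm.
have := ltn_pmod d (isT : (0 < 8)%N); have := ltn_pmod e (isT : (0 < 8)%N).
move: (d %% 8)%N (e %% 8)%N => a b.
by do 8?[case: a => [|a]; first by do 8?[case: b => [|b] //]].
Qed.

(** Indexing by the codivisor k over an interval prepares the exchange of summations in
    [sum_sum_chi]. *)
Definition sum_chi (n : nat) : int := \sum_(1 <= k < n.+1 | (k %| n)%N) chi (n %/ k).

Lemma sum_chi_divisors (n : nat) : (0 < n)%N ->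
  sum_chi n = \sum_(k <- divisors n) chi (n %/ k).
Proof.
move=> n0; rewrite /sum_chi -big_filter; apply: perm_big; apply: uniq_perm.
- by rewrite filter_uniq // iota_uniq.
- exact: divisors_uniq.
move=> k; rewrite mem_filter mem_index_iota -dvdn_divisors //.
by case: (boolP (k %| n)%N) => //= kn; have := dvdn_leq n0 kn; have := dvdn_gt0 n0 kn; lia.
Qed.

(** The divisors of p n that divide n contribute [chi p * sum_chi n]. The others are the p k with k
    | n and p k not dividing n. The remaining k | n, those with p k | n, are the divisors of n/p and
    account for the second term on the left. *)
Lemma sum_chi_prime (p n : nat) : prime p -> (0 < n)%N ->
  sum_chi (p * n) + (if (p %| n)%N then chi p * sum_chi (n %/ p) else 0)
  = (1 + chi p) * sum_chi n.
Proof.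
move=> p_pr n0; have p0 := prime_gt0 p_pr.
have pn0 : (0 < p * n)%N by rewrite muln_gt0 p0.
rewrite (sum_chi_divisors _ pn0) (sum_chi_divisors _ n0) (bigID (fun k => k %| n)%N) /=.
rewrite mulrDl mul1r.
have -> : \sum_(k <- divisors (p * n) | (k %| n)%N) chi (p * n %/ k)
          = chi p * \sum_(k <- divisors n) chi (n %/ k).
  rewrite mulr_sumr -big_filter.
  have eqd : perm_eq [seq k <- divisors (p * n) | (k %| n)%N] (divisors n).
    apply: uniq_perm; rewrite ?filter_uniq ?divisors_uniq // => k.
    rewrite mem_filter -!dvdn_divisors //.
    by case: (boolP (k %| n)%N) => //= kn; rewrite dvdn_mull.
  rewrite (perm_big _ eqd) !big_seq; apply: eq_bigr => k; rewrite -dvdn_divisors // => kn.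
  by rewrite -muln_divA // chiM.
have -> : \sum_(k <- divisors (p * n) | ~~ (k %| n)%N) chi (p * n %/ k)
          = \sum_(k <- divisors n | ~~ (p * k %| n)%N) chi (n %/ k).
  rewrite -big_filter -[RHS]big_filter.
  have eqd : perm_eq [seq k <- divisors (p * n) | ~~ (k %| n)%N]
      [seq (p * k)%N | k <- [seq k <- divisors n | ~~ (p * k %| n)%N]].
    apply: uniq_perm; rewrite ?filter_uniq ?divisors_uniq //.
      rewrite map_inj_uniq ?filter_uniq ?divisors_uniq // => a b /eqP.
      by rewrite eqn_pmul2l // => /eqP.
    move=> k; rewrite mem_filter -dvdn_divisors //; apply/andP/mapP => [[kn kpn]|].
      have pk : (p %| k)%N.
        apply: contraNT kn => pk; rewrite -(@Gauss_dvdr _ p) //.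
        by rewrite coprime_sym prime_coprime.
      exists (k %/ p)%N; last by rewrite mulnC divnK.
      rewrite mem_filter -dvdn_divisors // mulnC divnK // kn /=.
      by rewrite -(@dvdn_pmul2l p) // mulnC divnK.
    case=> j; rewrite mem_filter -dvdn_divisors // => /andP[pj jn] ->.
    by rewrite pj dvdn_pmul2l.
  rewrite (perm_big _ eqd) big_map; apply: eq_bigr => k _.
  by rewrite divnMA mulKn.
rewrite -addrA [RHS]addrC; congr (_ + _).
rewrite [RHS](bigID (fun k => p * k %| n)%N) /= addrC; congr (_ + _).
case: ifPn => [/dvdnP[m nE]|pn].
  have m0 : (0 < m)%N by move: n0; rewrite nE muln_gt0 => /andP[].
  rewrite nE mulnK // sum_chi_divisors // mulr_sumr -[RHS]big_filter.
  have eqd : perm_eq [seq k <- divisors (m * p) | (p * k %| m * p)%N] (divisors m).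
    apply: uniq_perm; rewrite ?filter_uniq ?divisors_uniq // => k.
    rewrite mem_filter -!dvdn_divisors ?muln_gt0 ?m0 // mulnC dvdn_pmul2r //.
    by case: (boolP (k %| m)%N) => //= kn; rewrite dvdn_mulr.
  rewrite (perm_big _ eqd) !big_seq; apply: eq_bigr => k; rewrite -dvdn_divisors // => kn.
  by rewrite mulnC -muln_divA // chiM.
rewrite big_pred0 // => k; apply/negbTE; apply: contra pn.
exact: dvdn_trans (dvdn_mulr _ _).
Qed.

(** * The recursion at primes and Dirichlet's formula *)

(** If p did not divide y, then x/y would be a square root of -2 mod p, so p = a^2 + 2b^2, which is
    never 5 or 7 mod 8. *)
Lemma card_rep_inert (p : nat) (n : nat) (u : int * int) : prime p -> chi p = -1 ->
  u \in rep (p * n) -> (p %| u.1)%Z && (p %| u.2)%Z.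
Proof.
move=> p_pr chip; rewrite mem_rep => /eqP h; have p0 := prime_gt0 p_pr.
have [py|py] := boolP (p %| u.2)%Z.
  rewrite andbT -[(_ %| _)%Z]orbb -prime_dvdzM //.
  have -> : u.1 * u.1 = p%:Z * n%:Z - 2 * u.2 * u.2 by lia.
  by rewrite rpredB //; [exact: dvdz_mulr|exact: dvdz_mull].
have y0 : u.2%:~R != 0 :> 'F_p by rewrite -dvdz_Fp.
have [|a [b ab]] := prime_form p (u.1%:~R / u.2%:~R) p_pr.
  have : (u.1 * u.1 + 2 * (u.2 * u.2))%:~R = 0 :> 'F_p.
    apply/eqP; rewrite -dvdz_Fp //; apply/dvdzP; exists n%:Z.
    by rewrite [RHS]mulrC -PoszM -h; ring.
  rewrite rmorphD !rmorphM /= => e.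
  apply: (mulIf (expf_neq0 2 y0)); rewrite -exprMn divfK //.
  by apply/eqP; rewrite -subr_eq0 -e; apply/eqP; ring.
move: chip; rewrite /chi !inE; case: ifP => // _; case: ifP => // p57 _.
have [q hq] := sqr_mod8 a; have [q' hq'] := sqr_mod8 b; lia.
Qed.

Lemma card_rep_prime (p n : nat) : prime p ->
  #|` rep (p * n)|%:Z + (if (p %| n)%N then chi p * #|` rep (n %/ p)%N|%:Z else 0)
  = (1 + chi p) * #|` rep n|%:Z.
Proof.
move=> p_pr; have p0 := prime_gt0 p_pr; have p1 := prime_gt1 p_pr.
have [->|p2] := eqVneq p 2%N.
  by rewrite card_rep_double [chi 2]/(0) addr0 mul0r if_same addr0 mul1r.
have p_odd : odd p by case: (even_prime p_pr) p2 => // ->.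
have := card_rep_multiples p n p0; set D := [fset u in _ | _]%fset => cD.
have -> : (if (p %| n)%N then chi p * #|` rep (n %/ p)%N|%:Z else 0) = chi p * #|` D|%:Z.
  by rewrite cD; case: ifP; rewrite ?mulr0.
have [p13|p57] : ((p %% 8 == 1) || (p %% 8 == 3))%N \/ chi p = -1.
  rewrite /chi !inE; case: ifP => [|h1]; first by left.
  by case: ifP => [_|h2]; [right|lia].
- have -> : chi p = 1 by rewrite /chi !inE p13.
  have [z z2] := sqr_neg2_Fp p p_pr p13.
  have [a [b ab]] := prime_form p z p_pr z2.
  have ab' : a ^+ 2 + 2 * (- b) ^+ 2 = p%:Z by rewrite sqrrN.
  have := card_rep_factor p n a b p_pr ab.
  have := card_rep_factor p n a (- b) p_pr ab'.
  set B := [fset u in _ | _]%fset => cB; set A := [fset u in _ | _]%fset => cA.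
  have ABu : (A `|` B)%fset = rep (p * n).
    apply/fsetP => u; rewrite !inE -andb_orr -prime_dvdzM //.
    case: (boolP (u \in _)) => //; rewrite mem_rep => /eqP h; apply/dvdzP.
    (* With u = (x, y), the product of the two linear forms is y^2 a^2 - x^2 b^2 = y^2 (a^2 + 2b^2)
       - b^2 (x^2 + 2y^2). *)
    exists (u.2 ^+ 2 - b ^+ 2 * n%:Z).
    transitivity (u.2 ^+ 2 * (a ^+ 2 + 2 * b ^+ 2)
      - b ^+ 2 * (u.1 ^+ 2 + 2 * u.2 ^+ 2)); first by ring.
    by rewrite h ab PoszM; ring.
  have ABi : (A `&` B)%fset = D.
    apply/fsetP => u; rewrite !inE -!andbA; case: (u \in _) => //=.
    have p_2 : ~~ (p %| 2)%Z.
      by apply/negP => /dvdn_leq => /(_ isT); move: p_odd p2; lia.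
    have p_ab : (p %| a)%Z = (p %| b)%Z.
      rewrite -[LHS]orbb -[RHS]orbb -!prime_dvdzM // -[RHS](orFb) -(negPf p_2).
      rewrite -prime_dvdzM //.
      have -> : a * a = p%:Z - 2 * (b * b) by rewrite -ab; ring.
      by rewrite rpredBl // dvdzz.
    (* Otherwise p^2 would divide a^2 + 2b^2 = p. *)
    have p_b : ~~ (p %| b)%Z.
      apply/negP => pb; have := pb; rewrite -p_ab => /dvdzP[q hq].
      case/dvdzP: pb => q' hq'; move: ab; rewrite hq hq' => ab.
      have /eqP : p%:Z * (p%:Z * (q ^+ 2 + 2 * q' ^+ 2)) = p%:Z * 1.
        by rewrite mulr1 -[RHS]ab; ring.
      rewrite (inj_eq (mulfI _)) => [/eqP h|]; last by lia.
      have : (p %| 1)%Z by apply/dvdzP; exists (q ^+ 2 + 2 * q' ^+ 2); rewrite mulrC h.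
      by rewrite dvdz1 /=; lia.
    have p_a : ~~ (p %| a)%Z by rewrite p_ab.
    (* The sum and difference of the two linear forms are 2 y a and 2 x b, and p divides none of 2,
       a, b. *)
    apply/andP/andP => [[h1 h2]|[h1 h2]].
      have : (p %| 2 * (u.1 * b))%Z.
        have -> : 2 * (u.1 * b) = (u.2 * a - u.1 * - b) - (u.2 * a - u.1 * b) by ring.
        by rewrite rpredB.
      have : (p %| 2 * (u.2 * a))%Z.
        have -> : 2 * (u.2 * a) = (u.2 * a - u.1 * - b) + (u.2 * a - u.1 * b) by ring.
        by rewrite rpredD.
      by rewrite !prime_dvdzM // (negPf p_2) (negPf p_a) (negPf p_b) !orbF.
    by split; rewrite rpredB // dvdz_mulr.
  have := cardfsUI A B; rewrite ABu ABi cA cB; lia.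
(* Inert case: every solution is a multiple of p, and both sides vanish. *)
rewrite p57 (_ : rep (p * n) = D); first lia.
apply/fsetP => u; rewrite !inE; case: (boolP (u \in _)) => //= h.
by rewrite (card_rep_inert p n).
Qed.

Lemma card_rep1 : #|` rep 1| = 2%N.
Proof.
have -> : rep 1 = [fset (1, 0); (-1, 0)]%fset.
  apply/fsetP => -[x y]; rewrite mem_rep !inE !xpair_eqE /=.
  by apply/eqP/idP; [nia|case/orP=> /andP[/eqP-> /eqP->]].
by rewrite cardfs2.
Qed.

(** Writing n = p m with p the least prime factor of n, the common recursion determines the value at
    n from those at m and m/p. *)
Lemma card_rep_sum_chi (n : nat) : (0 < n)%N -> #|` rep n|%:Z = 2 * sum_chi n.
Proof.
elim/ltn_ind: n => n IH n0; have [n1|n1] := leqP n 1.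
  have -> : n = 1%N by lia.
  by rewrite card_rep1 /sum_chi big_mkcond big_nat1.
have p_pr := pdiv_prime n1; have p1 := prime_gt1 p_pr.
have [m nE] := dvdnP (pdiv_dvd n); move: p_pr p1 nE.
move: (pdiv n) => p p_pr p1 nE; have m0 : (0 < m)%N by nia.
have mn : (m < n)%N by nia.
have := card_rep_prime p m p_pr; have := sum_chi_prime p m p_pr m0.
rewrite mulnC -nE (IH m) //.
case: ifP => [/dvdnP[k mE]|_]; last by lia.
have -> : (m %/ p = k)%N by rewrite mE mulnK // ltnW.
rewrite (IH k); [lia|nia|nia].
Qed.

(** * Summation over the ellipse *)

Lemma mem_ellipse (n : nat) (u : int * int) :
  (u \in fset_set (ellipse n)) = (u.1 ^+ 2 + 2 * u.2 ^+ 2 <= n%:Z).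
Proof.
rewrite in_fset_set; last exact: ellipse_finite.
by apply/idP/idP => [/set_mem|h]; last exact: mem_set.
Qed.

Lemma ellipse_count_sum (n : nat) :
  ellipse_count n = (1 + \sum_(1 <= m < n.+1) #|` rep m|)%N.
Proof.
elim: n => [|n IH].
  rewrite big_geq // addn0 /ellipse_count.
  have -> : fset_set (ellipse 0) = [fset (0, 0)]%fset.
    apply/fsetP => -[x y].
    by rewrite mem_ellipse inE xpair_eqE /=; apply/idP/andP; [split|case]; nia.
  by rewrite cardfs1.
rewrite big_nat_recr //= addnA -IH /ellipse_count -cardfsUI.
have -> : (fset_set (ellipse n) `&` rep n.+1 = fset0)%fset.
  apply/eqP; rewrite -fsubset0; apply/fsubsetP => u.
  rewrite inE mem_rep mem_ellipse => /andP[h /eqP hS].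
  by move: h; rewrite hS lez_nat ltnn.
rewrite cardfs0 addn0; congr (#|` _|); apply/fsetP => u.
have leS (t : int) : (t <= n.+1%:Z) = (t <= n%:Z) || (t == n.+1%:Z) by lia.
by rewrite inE mem_rep !mem_ellipse leS.
Qed.

(* Closed form of chi 1 + ... + chi q. *)
Definition psi (q : nat) : nat := (odd ((q + 3) %/ 4) + odd ((q + 1) %/ 4))%N.

(** Everything has period 8 in q: adding 8 to q raises each quotient by 2 and keeps its parity. This
    leaves eight cases. *)
Lemma psiS (q : nat) : (psi q.+1)%:Z = (psi q)%:Z + chi q.+1.
Proof.
have [m [r [-> r8]]] : exists m r, q = (m * 8 + r)%N /\ (r < 8)%N.
  by exists (q %/ 8)%N, (q %% 8)%N; rewrite -divn_eq ltn_pmod.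
rewrite /psi /chi -addnS modnMDl.
have e c (s : nat) : odd ((m * 8 + s + c) %/ 4) = odd ((s + c) %/ 4).
  by rewrite (_ : m * 8 + s + c = m * 2 * 4 + (s + c))%N; [rewrite divnMDl // oddD oddM andbF|lia].
by rewrite !e; move: r8; do 8?[case: r => [|r] //].
Qed.

(** From n to n + 1, the quotient [n %/ k] rises by one exactly when k divides n + 1, and [psi] then
    gains [chi (n.+1 %/ k)]. *)
Lemma sum_sum_chi (n : nat) :
  \sum_(1 <= m < n.+1) sum_chi m = \sum_(1 <= k < n.+1) (psi (n %/ k))%:Z.
Proof.
elim: n => [|n IH]; first by rewrite !big_geq.
rewrite big_nat_recr //= IH.
(* The added term k = n + 1 is [psi 0], which is 0. *)
have -> : \sum_(1 <= k < n.+1) (psi (n %/ k))%:Z = \sum_(1 <= k < n.+2) (psi (n %/ k))%:Z.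
  by rewrite [RHS]big_nat_recr //= divn_small // addr0.
rewrite /sum_chi [X in _ + X]big_mkcond -big_split /=; apply: eq_big_nat => k /andP[k0 _].
rewrite divnS //; case: (k %| n.+1)%N; last by rewrite add0n addr0.
by rewrite add1n psiS.
Qed.

Lemma ellipse_count_psi (n : nat) :
  (ellipse_count n)%:Z = 1 + 2 * \sum_(1 <= k < n.+1) (psi (n %/ k))%:Z.
Proof.
rewrite ellipse_count_sum PoszD -sum_sum_chi; congr (_ + _).
rewrite mulr_sumr -[LHS]natz natr_sum; apply: eq_big_nat => m /andP[m0 _].
by rewrite natz card_rep_sum_chi.
Qed.

(** * From floor counts to sums of parities *)

Lemma ceil_quarter (R : realType) (n : nat) :
  Num.ceil (n%:R / 4 : R) = ((n + 3) %/ 4)%N%:Z.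
Proof.
apply: ceil_def; rewrite intrD -[_%:~R]/(_%:R).
have : ((n <= (n + 3) %/ 4 * 4) && ((n + 3) %/ 4 * 4 <= n + 3))%N by lia.
rewrite -!(ler_nat R) !natrM natrD; set q := (_ %/ _)%N%:R; lra.
Qed.

Lemma floor_divn (R : realType) (a b : nat) : (0 < b)%N ->
  Num.floor (a%:R / b%:R : R) = (a %/ b)%N%:Z.
Proof.
move=> b0; have bR : 0 < b%:R :> R by rewrite ltr0n.
apply: floor_def; rewrite intrD -![_%:~R]/(_%:R) ler_pdivlMr // ltr_pdivrMr //.
rewrite -natrD -!natrM ler_nat ltr_nat; apply/andP; split; first exact: leq_divM.
by rewrite addn1 ltn_ceil.
Qed.

Lemma floor_quarter (R : realType) (n k c : nat) : (0 < k)%N ->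
  Num.floor (n%:R / 4 / k%:R + c%:R / 4 : R) = ((n %/ k + c) %/ 4)%N%:Z.
Proof.
move=> k0; have kR : 0 < k%:R :> R by rewrite ltr0n.
have -> : n%:R / 4 / k%:R + c%:R / 4 = (n + c * k)%N%:R / (4 * k)%N%:R :> R.
  by rewrite natrD !natrM; field; lra.
have -> : ((n %/ k + c) %/ 4 = (n + c * k) %/ (4 * k))%N.
  by rewrite [(4 * k)%N]mulnC divnMA addnC [(n + _)%N]addnC divnMDl.
by rewrite floor_divn // muln_gt0.
Qed.

(** The shift {-n/4} is the excess of ceil(n/4) over n/4, so the numerator in [floor_set] is exactly
    n/4. *)
Lemma floor_count_quarter (R : realType) (n c : nat) :
  floor_count (Num.ceil (n%:R / 4 : R)) (c%:R / 4)
    (frac_part (- (n%:R / 4) : R)) 1 2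
  = (\sum_(1 <= k < ((n + 3) %/ 4).+1) odd ((n %/ k + c) %/ 4))%N.
Proof.
rewrite /floor_count; set S := floor_set _ _ _ _ _.
set N := ((n + 3) %/ 4)%N.
have -> : fset_set S = seq_fset tt [seq k%:Z | k <- index_iota 1 N.+1 & odd ((n %/ k + c) %/ 4)].
  apply/fsetP => k; rewrite in_fset_set; last exact: floor_set_finite.
  rewrite seq_fsetE; have inS (j : nat) : (0 < j)%N ->
      Num.floor (((Num.ceil (n%:R / 4 : R))%:~R - frac_part (- (n%:R / 4)))
        / (j%:Z)%:~R + c%:R / 4 : R) = ((n %/ j + c) %/ 4)%N%:Z.
    move=> j0; rewrite -(@floor_quarter R) //; congr Num.floor.
    by rewrite /frac_part ceilNfloor rmorphN /=; congr (_ / _ + _); ring.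
  apply/idP/mapP => [/set_mem [/andP[k1 kn]]|].
    have kE : k = `|k|%N%:Z by lia.
    rewrite {}kE in k1 kn *; rewrite inS; last by lia.
    move=> h; exists `|k|%N => //.
    rewrite mem_filter mem_index_iota; apply/andP; split; first by lia.
    by move: kn; rewrite ceil_quarter; lia.
  case=> j; rewrite mem_filter mem_index_iota => /andP[h1 h2] ->.
  apply: mem_set; split; first by rewrite ceil_quarter; lia.
  by rewrite inS; lia.
rewrite size_seq_fset undup_id.
  by rewrite size_map size_filter -sum1_count big_mkcond; apply: eq_bigr => k _; case: odd.
by rewrite map_inj_uniq ?filter_uniq ?iota_uniq // => a b [].
Qed.

(** For ceil(n/4) < k <= n the quotient [n %/ k] is 1, 2 or 3, and each term is 1. *)
Lemma sum_odd_quarter3 (n : nat) :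
  (\sum_(1 <= k < n.+1) odd ((n %/ k + 3) %/ 4)
   = \sum_(1 <= k < ((n + 3) %/ 4).+1) odd ((n %/ k + 3) %/ 4)
     + (n - (n + 3) %/ 4))%N.
Proof.
rewrite (@big_cat_nat _ _ _ ((n + 3) %/ 4).+1) //=; last by lia.
congr addn; rewrite -[RHS]muln1 -subSS -sum_nat_const_nat.
apply: eq_big_nat => k /andP[k1 k2].
have -> : ((n %/ k + 3) %/ 4 = 1)%N; last by [].
have h1 : (1 <= n %/ k)%N by rewrite leq_divRL; lia.
have h2 : (n %/ k < 4)%N by rewrite ltn_divLR; lia.
lia.
Qed.

(** For k > ceil(n/4) the quotient [n %/ k] is at most 3, and the term is 1 exactly when it equals
    3, that is, when k <= n/3. *)
Lemma sum_odd_quarter1 (n : nat) : ((n + 3) %/ 4 <= n %/ 3)%N ->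
  (\sum_(1 <= k < n.+1) odd ((n %/ k + 1) %/ 4)
   = \sum_(1 <= k < ((n + 3) %/ 4).+1) odd ((n %/ k + 1) %/ 4)
     + (n %/ 3 - (n + 3) %/ 4))%N.
Proof.
move=> hn; rewrite (@big_cat_nat _ _ _ (n %/ 3).+1) //=; last by lia.
rewrite [X in (_ + X)%N]big_nat_cond [X in (_ + X)%N]big1 => [|k /andP[/andP[k1 k2] _]]; last first.
  have -> : ((n %/ k + 1) %/ 4 = 0)%N; last by [].
  have h2 : (n %/ k < 3)%N by rewrite ltn_divLR; lia.
  by apply: divn_small; rewrite addn1 ltnS.
rewrite addn0 (@big_cat_nat _ _ _ ((n + 3) %/ 4).+1) //=.
congr addn; rewrite -[RHS]muln1 -subSS -sum_nat_const_nat.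
apply: eq_big_nat => k /andP[k1 k2].
have -> : ((n %/ k + 1) %/ 4 = 1)%N; last by [].
have h1 : (3 <= n %/ k)%N by rewrite leq_divRL; lia.
have h2 : (n %/ k < 4)%N by rewrite ltn_divLR; lia.
lia.
Qed.

Theorem corollary5p10 (R : realType) :
  [/\ ellipse_count 0 = 1%N, ellipse_count 1 = 3%N, ellipse_count 2 = 5%N
    & ellipse_count 5 = 11%N] /\
  forall n : nat, (0 < n)%N -> n <> 1%N -> n <> 2%N -> n <> 5%N ->
    (ellipse_count n)%:Z =
      1 + 2 * (floor_count (Num.ceil (n%:R / 4 : R)) (3 / 4)
                 (frac_part (- (n%:R / 4) : R)) 1 2)%:Z
        + 2 * (floor_count (Num.ceil (n%:R / 4 : R)) (1 / 4)
                 (frac_part (- (n%:R / 4) : R)) 1 2)%:Z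
        + 2 * n%:Z + 2 * Num.floor (n%:R / 3 : R) - 4 * Num.ceil (n%:R / 4 : R).
Proof.
split.
  (* The small values are computed from the [psi] formula. *)
  by split; apply/eqP; rewrite -eqz_nat ellipse_count_psi unlock.
move=> n n0 n1 n2 n5.
rewrite ellipse_count_psi (@floor_count_quarter R n 3) (@floor_count_quarter R n 1).
rewrite ceil_quarter (@floor_divn R n 3) //.
have -> : \sum_(1 <= k < n.+1) (psi (n %/ k))%:Z
  = (\sum_(1 <= k < n.+1) odd ((n %/ k + 3) %/ 4)
     + \sum_(1 <= k < n.+1) odd ((n %/ k + 1) %/ 4))%N%:Z.
  rewrite -big_split /= -[RHS]natz natr_sum.
  by apply: eq_bigr => k _; rewrite natz.
(* Excluding 1, 2 and 5 gives ceil(n/4) <= floor(n/3), so the truncated subtractions are exact. *)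
rewrite sum_odd_quarter3 sum_odd_quarter1; lia.
Qed.
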